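(* Let $\Psi = \exists^{\geq 2} v_1 \cdots \exists^{\geq 2} v_m\, \psi$ be an instance of $\{2\}$-CSP$(\mathbb{K}_4)$, let $G$ be its graph and $<$ its quantification order, and let $F$, $R^+$, $R^-$ be the sets obtained from $G$ by the closure procedure described in the context. Then the following are equivalent: (i) $\mathbb{K}_4 \models \Psi$; (ii) Prover has a winning strategy in the game $\mathscr{G}(\Psi,\mathbb{K}_4)$; (iii) Prover can play the game $\mathscr{G}(\Psi,\mathbb{K}_4)$ so that in every play the resulting mapping $f: V(G)\to\{1,2,3,4\}$ satisfies: (S1) for every $xy \in F$, $f(x)\neq f(y)$; (S2) for every $xyz\in R^+$ with $x<y<z$: if $f(x)\neq f(y)$ then $f(z)\in\{f(x),f(y)\}$; (S3) for every $xyz \in R^-$ with $x<y<z$: if $f(x)\neq f(y)$ then $f(z)\notin\{f(x),f(y)\}$; (iv) there is no triple $xyz \in R^+$ with $x<y<z$ such that $xz\in F$ or $yz\in F$, or $xwz\in R^-$ for some $w<z$ (possibly $w=y$), or $ywz \in R^-$ for some $w$ with $y<w<z$.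
   Context: $\mathbb{K}_4$ is the complete loopless graph on $\{1,2,3,4\}$. In $\{2\}$-CSP$(\mathbb{K}_4)$ the input is a sentence in which every variable is quantified by $\exists^{\geq 2}$ (''there exist at least 2 distinct elements'') and the quantifier-free part $\psi$ is a conjunction of atoms $E(v_i,v_k)$; the question is whether it holds in $\mathbb{K}_4$. The graph $G=\mathcal{D}_\psi$ has the variables as vertices and an edge $v_iv_k$ whenever $E(v_i,v_k)$ occurs in $\psi$; $<$ is the total order of the variables by order of quantification (left to right). For sets of vertices, $\{x,y\}<z$ means $x<z$ and $y<z$, etc. Game $\mathscr{G}(\Psi,\mathbb{K}_4)$: working through the variables in the order $<$, for each variable $x$ Prover chooses a set of $2$ distinct elements of $\{1,2,3,4\}$ and Adversary chooses one of them as $f(x)$; Prover wins if the final $f$ is a homomorphism from $G$ to $\mathbb{K}_4$. A play of the game produces the mapping $f$. Closure procedure: $F$ is a set of unordered pairs of vertices (written $xy$), $R^+$ and $R^-$ are sets of unordered triples (written $xyz$). Initially $F=E(G)$, $R^+=R^-=\emptyset$; then the following rules are applied as long as they add something: (X1) If $\{x,y\}<z$ with $xz,yz\in F$, add $xyz$ to $R^-$. (X2) If $\{x,y,w\}<z$ with $wz\in F$ and $xyz\in R^-$, add $xyw$ to $R^+$. (X3) If $\{x,y,w\}<z$ with $wz \in F$ and $xyz\in R^+$: if $\{x,y\}<w$, add $xyw$ to $R^-$; otherwise add $xw$ and $yw$ to $F$. (X4) If $\{x,w\}<y<z$ with $xyz\in R^+$ and $wyz\in R^-$, add $xw$ to $F$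 and $xyw$ to $R^+$. (X5) If $\{x,y,w\}<z$ and either $xyz,wyz\in R^+$ or $xyz,wyz\in R^-$, add $xyw$ to $R^+$. (X6) If $\{x,y,w\}<q<z$ and either $xyz,wqz\in R^+$ or $xyz,wqz\in R^-$, add $xyw$ and $xyq$ to $R^+$. (X7) If $\{x,y,w\}<q<z$ and either ($xyz\in R^+$ and $wqz\in R^-$) or ($xyz\in R^-$ and $wqz\in R^+$), add $xyq$ to $R^-$, and if $\{x,y\}<w$ also add $xyw$ to $R^-$, otherwise add $xw$ and $yw$ to $F$.
   Formalization: The formal statement assumes that ψ contains no atom E(v,v), i.e. that G is loopless; without this the claim fails (for m = 1 and ψ = E(v_1,v_1), (i) is false but (iv) is true). *)

(* Defs.v *)
From mathcomp Require Import all_boot.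

Set Implicit Arguments.
Unset Strict Implicit.
Unset Printing Implicit Defensive.

Section Logic.

Variable V : eqType.

(* [AtLeast n x phi] is the counting quantifier "there exist at least n
   distinct elements x such that phi". *)
Inductive formula : Type :=
  | Top
  | Atom of V & V
  | And of formula & formula
  | AtLeast of nat & V & formula.

Variables (T : finType) (e : rel T).

Definition upd (s : V -> T) (x : V) (a : T) : V -> T :=
  fun y => if y == x then a else s y.

Fixpoint holds (s : V -> T) (phi : formula) : bool :=
  match phi with
  | Top => true
  | Atom x y => e (s x) (s y)
  | And phi1 phi2 => holds s phi1 && holds s phi2
  | AtLeast n x phi1 => n <= #|[set a | holds (upd s x a) phi1]|
  end.

(* For a sentence, the truth value does not depend on the assignment [s]. *)
Definition models (phi : formula) : Prop := forall s, holds s phi.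

End Logic.

(* The elements 1, 2, 3, 4 are represented by the ordinals 0, 1, 2, 3. *)
Definition K4 : rel 'I_4 := fun a b => a != b.

(* The variables v_1, ..., v_m are the ordinals in 'I_m, and their order of
   quantification is the order of 'I_m.  A conjunction of atoms is given by the
   list of its atoms, (x, y) standing for E(x, y). *)
Section Instance.

Variables (m : nat) (psi : seq ('I_m * 'I_m)).

Definition matrix_of : formula 'I_m :=
  foldr (fun a phi => And (Atom a.1 a.2) phi) (Top _) psi.

Definition sentence_of : formula 'I_m :=
  foldr (fun x phi => AtLeast 2 x phi) matrix_of (enum 'I_m).

Definition edge : rel 'I_m :=
  fun x y => ((x, y) \in psi) || ((y, x) \in psi).

(* As Prover's own earlier moves are determined by her strategy, it suffices
   that a strategy depend on the sequence of Adversary's earlier answers; its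
   length tells which variable is to be played. *)
Record strategy := Strategy {
  offer :> seq 'I_4 -> {set 'I_4};
  offer_card : forall h, #|offer h| = 2
}.

Definition history (f : {ffun 'I_m -> 'I_4}) (x : 'I_m) : seq 'I_4 :=
  [seq f y | y : 'I_m <- enum 'I_m & y < x].

Definition is_play (sigma : strategy) (f : {ffun 'I_m -> 'I_4}) : Prop :=
  forall x, f x \in sigma (history f x).

Definition is_hom (f : {ffun 'I_m -> 'I_4}) : Prop :=
  forall x y, edge x y -> K4 (f x) (f y).

Definition prover_can_force (Q : {ffun 'I_m -> 'I_4} -> Prop) : Prop :=
  exists sigma : strategy, forall f, is_play sigma f -> Q f.

Definition prover_wins : Prop := prover_can_force is_hom.

(* [before s z] : the vertices listed in [s] are pairwise distinct and all
   precede [z].  Distinctness makes every pair and triple named in the rules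
   below a genuine 2-element, resp. 3-element, set. *)
Definition before (s : seq 'I_m) (z : 'I_m) : bool :=
  uniq s && all (fun x : 'I_m => x < z) s.

(* [inR true] is membership in R+ and [inR false] membership in R-; X5_R
   and X6_* have two premises of equal sign, X7_* two of opposite signs. *)
Inductive inF : {set 'I_m} -> Prop :=
  | F_edge x y of edge x y : inF [set x; y]
  | X3_F1 x y w z of before [:: x; y; w] z & inF [set w; z]
      & inR true [set x; y; z] & ~~ before [:: x; y] w : inF [set x; w]
  | X3_F2 x y w z of before [:: x; y; w] z & inF [set w; z]
      & inR true [set x; y; z] & ~~ before [:: x; y] w : inF [set y; w]
  | X4_F x y w (z : 'I_m) of before [:: x; w] y & y < z
      & inR true [set x; y; z] & inR false [set w; y; z] : inF [set x; w]
  | X7_F1 b x y w q (z : 'I_m) of before [:: x; y; w] q & q < z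
      & inR b [set x; y; z] & inR (~~ b) [set w; q; z]
      & ~~ before [:: x; y] w : inF [set x; w]
  | X7_F2 b x y w q (z : 'I_m) of before [:: x; y; w] q & q < z
      & inR b [set x; y; z] & inR (~~ b) [set w; q; z]
      & ~~ before [:: x; y] w : inF [set y; w]
with inR : bool -> {set 'I_m} -> Prop :=
  | X1_R x y z of before [:: x; y] z & inF [set x; z]
      & inF [set y; z] : inR false [set x; y; z]
  | X2_R x y w z of before [:: x; y; w] z & inF [set w; z]
      & inR false [set x; y; z] : inR true [set x; y; w]
  | X3_R x y w z of before [:: x; y; w] z & inF [set w; z]
      & inR true [set x; y; z] & before [:: x; y] w : inR false [set x; y; w]
  | X4_R x y w (z : 'I_m) of before [:: x; w] y & y < z
      & inR true [set x; y; z] & inR false [set w; y; z] :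
      inR true [set x; y; w]
  | X5_R b x y w z of before [:: x; y; w] z
      & inR b [set x; y; z] & inR b [set w; y; z] : inR true [set x; y; w]
  | X6_R1 b x y w q (z : 'I_m) of before [:: x; y; w] q & q < z
      & inR b [set x; y; z] & inR b [set w; q; z] : inR true [set x; y; w]
  | X6_R2 b x y w q (z : 'I_m) of before [:: x; y; w] q & q < z
      & inR b [set x; y; z] & inR b [set w; q; z] : inR true [set x; y; q]
  | X7_R1 b x y w q (z : 'I_m) of before [:: x; y; w] q & q < z
      & inR b [set x; y; z] & inR (~~ b) [set w; q; z] :
      inR false [set x; y; q]
  | X7_R2 b x y w q (z : 'I_m) of before [:: x; y; w] q & q < z
      & inR b [set x; y; z] & inR (~~ b) [set w; q; z]
      & before [:: x; y] w : inR false [set x; y; w].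

Definition inRplus : {set 'I_m} -> Prop := inR true.
Definition inRminus : {set 'I_m} -> Prop := inR false.

Definition S1 (f : {ffun 'I_m -> 'I_4}) : Prop :=
  forall x y, inF [set x; y] -> f x <> f y.

Definition S2 (f : {ffun 'I_m -> 'I_4}) : Prop :=
  forall x y z : 'I_m, x < y -> y < z -> inRplus [set x; y; z] ->
    f x <> f y -> f z \in [set f x; f y].

Definition S3 (f : {ffun 'I_m -> 'I_4}) : Prop :=
  forall x y z : 'I_m, x < y -> y < z -> inRminus [set x; y; z] ->
    f x <> f y -> f z \notin [set f x; f y].

Definition bad_triple (x y z : 'I_m) : Prop :=
  [/\ x < y, y < z, inRplus [set x; y; z] &
    [\/ inF [set x; z], inF [set y; z],
        exists2 w : 'I_m, w < z & inRminus [set x; w; z]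
      | exists2 w : 'I_m, y < w < z & inRminus [set y; w; z]]].

End Instance.

(* Main.v *)
(* At a vertex z, a nontrivial R+ or R- condition, or two distinct colours on
   F-neighbours, pins down Prover's offer: among four colours it must be
   {f(x), f(y)} or its complement.  Each closure rule expresses that two
   conditions at z must pin down the same offer, once Adversary has used her
   freedom to recolour the last of the earlier vertices; hence every play of
   any winning strategy satisfies (S1)-(S3).  Conversely, if (S1)-(S3) hold on
   the vertices before z and no triple is bad, then closure under the rules
   makes all conditions at z agree, so at least two colours remain for z. *)
Require Import Defs.
From mathcomp Require Import all_boot.
From mathcomp Require Import zify.

Set Implicit Arguments.
Unset Strict Implicit.
Unset Printing Implicit Defensive.

(* Induction principles and small sets *)
Scheme inF_mut := Minimality for inF Sort Prop
  with inR_mut := Minimality for inR Sort Prop.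
Combined Scheme inF_inR_ind from inF_mut, inR_mut.

Lemma set3C12 (T : finType) (x y z : T) : [set x; y; z] = [set y; x; z].
Proof. by rewrite (setUC [set x]). Qed.

Lemma set3C23 (T : finType) (x y z : T) : [set x; y; z] = [set x; z; y].
Proof. by rewrite setUAC. Qed.

Lemma set2_eq (T : finType) (a b c d : T) :
  c != d -> c \in [set a; b] -> d \in [set a; b] -> [set a; b] = [set c; d].
Proof.
rewrite !inE => cd /orP[]/eqP cE /orP[]/eqP dE; rewrite cE dE ?eqxx // in cd *.
by rewrite setUC.
Qed.

(** Quantifiers are treated from the last one backwards: [k] counts the vertices already coloured,
    and from [m] on none is left. *)
Lemma downward_ind m (P : nat -> Prop) :
  (forall k, m <= k -> P k) -> (forall x : 'I_m, P x.+1 -> P x) ->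
  forall k, P k.
Proof.
move=> P_large P_step k; have [n] := ubnP (m - k).
elim: n k => // n IHn k; rewrite ltnS => le_n.
have [km|/P_large//] := ltnP k m.
by apply: (P_step (Ordinal km)); apply: IHn; rewrite /=; lia.
Qed.

Lemma imset_set3 (aT rT : finType) (f : aT -> rT) x y z :
  f @: [set x; y; z] = [set f x; f y; f z].
Proof. by rewrite !imsetU !imset_set1. Qed.

(** Links the symmetric reading of R+ (three colours not all distinct) with the form it takes in
    (S2). *)
Lemma card_set3_le2 (T : finType) (a b c : T) :
  (#|[set a; b; c]| <= 2) = ((a != b) ==> (c \in [set a; b])).
Proof.
rewrite setUC cardsU1 cards2 !inE.
by case: (a =P b); case: ((c == a) || (c == b)).
Qed.

Lemma before2 m (x y z : 'I_m) :
  before [:: x; y] z = [&& x != y, x < z & y < z].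
Proof. by rewrite /before /= !inE !andbT. Qed.

Lemma before3 m (x y w z : 'I_m) :
  before [:: x; y; w] z =
  [&& x != y, x != w, y != w, x < z, y < z & w < z].
Proof. by rewrite /before /= !inE !andbT negb_or -!andbA. Qed.

(** * Plays against a fixed strategy *)

Section Plays.

Variables (m : nat) (sigma : strategy).
Implicit Types f g : {ffun 'I_m -> 'I_4}.

Lemma historyE f (x : 'I_m) : history f x = [seq f y | y <- take x (enum 'I_m)].
Proof.
congr map; apply: (inj_map val_inj).
rewrite map_take -(filter_map val (fun k => k < x)) val_enum_ord.
by rewrite (@filter_iota_ltn 0) ?take_iota ?(minn_idPl _) // ltnW.
Qed.

Lemma size_history f x : size (history f x) = x.
Proof. by rewrite historyE size_map size_takel // size_enum_ord ltnW. Qed.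

Lemma nth_history f (x y : 'I_m) a : y < x -> nth a (history f x) y = f y.
Proof.
move=> yx; rewrite historyE (nth_map x) ?nth_take ?nth_ord_enum //.
by rewrite size_takel // size_enum_ord ltnW.
Qed.

Lemma eq_history f g (x : 'I_m) :
  (forall y : 'I_m, y < x -> g y = f y) -> history g x = history f x.
Proof.
by move=> fg; apply/eq_in_map => y; rewrite mem_filter => /andP[/fg].
Qed.

(** An offer is never empty and depends only on earlier answers, so a partial play can be continued
    one vertex at a time. *)
Lemma extend_play k f :
  (forall x : 'I_m, x < k -> f x \in sigma (history f x)) ->
  exists2 g, is_play sigma g & forall x : 'I_m, x < k -> g x = f x.
Proof.
elim/(@downward_ind m): k f => [k mk|x IHx] f fP.
  by exists f => // x; apply/fP/(leq_trans _ mk).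
have /card_gt0P[a aP] : 0 < #|sigma (history f x)| by rewrite offer_card.
pose g : {ffun 'I_m -> 'I_4} := [ffun y => if y == x then a else f y].
have gf (y : 'I_m) : y < x -> g y = f y.
  by move=> yx; rewrite ffunE -val_eqE /= ltn_eqF.
have [y|h hP hg] := IHx g; last first.
  by exists h => // y yx; rewrite hg ?gf // ltnS ltnW.
rewrite ltnS leq_eqVlt => /orP[/eqP/val_inj->|yx].
  by rewrite (eq_history gf) ffunE eqxx.
by rewrite gf // (eq_history (f := f)) ?fP // => z zy; apply/gf/(ltn_trans zy).
Qed.

Variables (f : {ffun 'I_m -> 'I_4}) (fP : is_play sigma f) (z : 'I_m).

Lemma answer c : c \in sigma (history f z) ->
  exists g, [/\ is_play sigma g, forall x : 'I_m, x < z -> g x = f x & g z = c].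
Proof.
move=> cP; pose g : {ffun _} := [ffun y => if y == z then c else f y].
have gf (y : 'I_m) : y < z -> g y = f y.
  by move=> yz; rewrite ffunE -val_eqE /= ltn_eqF.
have [|h hP hg] := @extend_play z.+1 g.
  move=> y; rewrite ltnS leq_eqVlt => /orP[/eqP/val_inj->|yz].
    by rewrite (eq_history gf) ffunE eqxx.
  by rewrite gf // (eq_history (f := f)) ?fP // => x xy; apply/gf/(ltn_trans xy).
exists h; split=> // [x xz|]; first by rewrite hg ?gf // ltnS ltnW.
by rewrite hg ?ltnSn // ffunE eqxx.
Qed.

(** Adversary's freedom: an offer of two colours does not fit into [[set c]]. *)
Lemma answer_neq c :
  exists g, [/\ is_play sigma g, forall x : 'I_m, x < z -> g x = f x & g z != c].
Proof.
have /subsetPn[d /answer[g [gP gf gz]] dc] :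
    ~~ (sigma (history f z) \subset [set c]).
  by apply/negP => /subset_leq_card; rewrite offer_card cards1.
by exists g; split; rewrite // gz -in_set1.
Qed.

End Plays.

(** * Soundness of the closure rules *)

Section Soundness.

Variables (m : nat) (psi : seq ('I_m * 'I_m)) (sigma : strategy).
Implicit Types x y w q z : 'I_m.
Hypothesis sigma_wins : forall f, is_play sigma f -> is_hom psi f.

Definition apart (x y : 'I_m) : Prop :=
  forall f : {ffun 'I_m -> 'I_4}, is_play sigma f -> f x != f y.

(** Covers (S2) with [b = true] and (S3) with [b = false]. No order is imposed, since some rules
    pass through triples whose last listed vertex is not the latest. *)
Definition selects b (x y z : 'I_m) : Prop :=
  forall f : {ffun 'I_m -> 'I_4}, is_play sigma f -> f x != f y ->
  (f z \in [set f x; f y]) = b.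

(** Phrased through the image, so that it depends on the set alone, as the induction over the
    closure requires. *)
Definition validF (S : {set 'I_m}) : Prop :=
  forall f : {ffun 'I_m -> 'I_4}, is_play sigma f -> #|f @: S| = 2.

(* Membership of a triple in R+ says that its three colours are not all
   distinct, which does not depend on the order of its vertices. *)
Definition validR b (S : {set 'I_m}) : Prop :=
  if b then forall f : {ffun 'I_m -> 'I_4}, is_play sigma f -> #|f @: S| <= 2
  else forall x y z, x \in S -> y \in S -> z \in S -> x < z -> y < z ->
    selects false x y z.

Lemma validF2 x y : validF [set x; y] <-> apart x y.
Proof.
split=> xyP f /xyP; rewrite imsetU1 imset_set1 cards2.
  by case: eqP.
by move->.
Qed.

Lemma selects_sym b x y z : selects b x y z -> selects b y x z.
Proof. by move=> xy f /xy; rewrite eq_sym setUC. Qed.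

(** For R- the hypothesis makes [z] the latest vertex, so a listing with distinct first two vertices
    must end in [z] and at most swaps [x] and [y]. *)
Lemma validR3 b x y z : b || (x < z) && (y < z) ->
  validR b [set x; y; z] <-> selects b x y z.
Proof.
case: b => [_|/andP[xz yz]]; split=> xyP.
- by move=> f /xyP; rewrite imset_set3 card_set3_le2 => /implyP.
- by move=> f /xyP; rewrite imset_set3 card_set3_le2 => /implyP.
- by apply: xyP => //; rewrite !inE eqxx ?orbT.
move=> x' y' z' x'S y'S z'S x'z' y'z' f fP x'y'.
move: x'S y'S z'S; rewrite !inE -!orbA.
case/or3P=> /eqP x'E; case/or3P=> /eqP y'E; case/or3P=> /eqP z'E; subst;
  try by [lia | rewrite eqxx in x'y'].
- by have := xyP f fP x'y'; rewrite !inE.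
- by have := selects_sym xyP fP x'y'; rewrite !inE.
Qed.

Lemma validR_plus x y z :
  validR true [set x; y; z] <-> selects true x y z.
Proof. exact: validR3. Qed.

Lemma validR_elim b x y z : x < z -> y < z ->
  validR b [set x; y; z] -> selects b x y z.
Proof. by move=> xz yz /validR3; apply; rewrite xz yz orbT. Qed.

Lemma validR_minus x y z : x < z -> y < z ->
  selects false x y z -> validR false [set x; y; z].
Proof. by move=> xz yz xyzP; apply/validR3; rewrite ?xz. Qed.

Lemma apart2_selects x y z :
  apart x z -> apart y z -> selects false x y z.
Proof.
move=> xzP yzP f fP _.
by rewrite !inE !(eq_sym (f z)) (negPf (xzP _ fP)) (negPf (yzP _ fP)).
Qed.

(* As there are four colours, a nontrivial R+ or R- condition at [z] leaves
   Prover a single possible offer. *)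
Lemma selects_offer b x y z f : x < z -> y < z -> selects b x y z ->
    is_play sigma f -> f x != f y ->
  sigma (history f z) = if b then [set f x; f y] else ~: [set f x; f y].
Proof.
move=> xz yz xyzP fP fxy; apply/eqP; rewrite eqEcard offer_card.
apply/andP; split.
  apply/subsetP => c /(answer fP)[g [gP gf <-]].
  have := xyzP g gP; rewrite (gf x) // (gf y) // => /(_ fxy).
  by case: (b) => //; rewrite in_setC => ->.
by case: (b); last rewrite cardsCs setCK card_ord; rewrite cards2 fxy.
Qed.

Lemma apart_offer w z f : w < z -> apart w z -> is_play sigma f ->
  f w \notin sigma (history f z).
Proof.
move=> wz wzP fP; apply/negP => /(answer fP)[g [gP gf gz]].
by have := wzP g gP; rewrite gz gf // eqxx.
Qed.

(** Behind (X2) and (X3): the offer at [z] is [[set f x; f y]] or its complement, and it must omit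
    [f w]. *)
Lemma apart_selects b x y w z : x < z -> y < z -> w < z -> apart w z ->
  selects b x y z -> selects (~~ b) x y w.
Proof.
move=> xz yz wz wzP xyzP f fP xy.
have := apart_offer wz wzP fP; rewrite (selects_offer xz yz xyzP fP xy).
by case: (b) => [/negPf//|]; rewrite in_setC negbK.
Qed.

(** Both conditions determine the one offer at [z]. *)
Lemma selects_inj b x y w q z f : x < z -> y < z -> w < z -> q < z ->
    selects b x y z -> selects b w q z -> is_play sigma f ->
  f x != f y -> f w != f q -> [set f x; f y] = [set f w; f q].
Proof.
move=> xz yz wz qz xyzP wqzP fP xy wq.
have := selects_offer xz yz xyzP fP xy.
rewrite (selects_offer wz qz wqzP fP wq).
by case: (b) => [->|/setC_inj->].
Qed.

Lemma selects_compl b x y w q z f : x < z -> y < z -> w < z -> q < z ->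
    selects b x y z -> selects (~~ b) w q z -> is_play sigma f ->
  f x != f y -> f w != f q -> [set f w; f q] = ~: [set f x; f y].
Proof.
move=> xz yz wz qz xyzP wqzP fP xy wq.
have := selects_offer xz yz xyzP fP xy.
rewrite (selects_offer wz qz wqzP fP wq).
by case: (b) => [<-|//]; rewrite setCK.
Qed.

(* If [w] is not the last vertex of the triple, Adversary may recolour the last
   one, so the condition on [f x] and [f y] being distinct can be dropped. *)
Lemma selects_false_apart x y w : x != y -> x != w -> y != w ->
  ~~ before [:: x; y] w -> selects false x y w -> apart x w /\ apart y w.
Proof.
wlog xy : x y / x < y => [IH|].
  move=> xy xw yw b P; have [lt_xy|lt_yx|/val_inj/eqP] := ltngtP x y.
  - exact: IH.
  - have [] // := IH _ _ lt_yx; first by rewrite eq_sym.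
      by move: b; rewrite !before2 eq_sym (andbC (x < w)).
    exact: selects_sym.
  - by rewrite (negPf xy).
move=> _ xw yw; rewrite before2 => b P.
have wy : w < y by move: b; rewrite -!val_eqE /= in xw yw *; lia.
have xwP : apart x w.
  (* As [y] is the latest of the three, a new answer there makes its colour differ from [f x] and
     keeps [f x] and [f w]. *)
  move=> f fP; have [g [gP gf gy]] := answer_neq fP y (f x).
  have := P g gP; rewrite (gf x) // (gf w) // eq_sym => /(_ gy).
  by rewrite !inE eq_sym => /norP[].
split=> // f fP; have := P f fP; have [<- _|_ /(_ isT)] := eqP.
  exact: xwP.
by rewrite !inE !(eq_sym (f w)) => /norP[].
Qed.

(** The F-part of (X4): if [f x = f w], Adversary answers at [y] with another colour, and the same
    pair of colours is both demanded and excluded at [z]. *)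
Lemma selects_cross_apart x y w z : x < y -> w < y -> y < z ->
  selects true x y z -> selects false w y z -> apart x w.
Proof.
move=> xy wy yz xyzP wyzP f fP; apply/eqP => xw.
have [g [gP gf gy]] := answer_neq fP y (f x).
have gxy : g x != g y by rewrite gf // eq_sym.
have := xyzP g gP gxy; have := wyzP g gP; rewrite (gf w) // -xw -(gf x) //.
by move=> ->.
Qed.

(** The R+ part of (X4): complementary pairs cannot share [f y], so [w] must take the colour of
    [y]. *)
Lemma selects_cross x y w z : x < z -> y < z -> w < z ->
  selects true x y z -> selects false w y z -> selects true x y w.
Proof.
move=> xz yz wz xyzP wyzP f fP xy; have [wy|wy] := eqVneq (f w) (f y).
  by rewrite wy !inE eqxx orbT.
have /setP/(_ (f y)) := selects_compl xz yz wz yz xyzP wyzP fP xy wy.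
by rewrite !inE eqxx !orbT.
Qed.

Lemma selects_common b x y w z : x < z -> y < z -> w < z ->
  selects b x y z -> selects b w y z -> selects true x y w.
Proof.
move=> xz yz wz xyzP wyzP f fP xy; have [wy|wy] := eqVneq (f w) (f y).
  by rewrite wy !inE eqxx orbT.
by rewrite (selects_inj xz yz wz yz xyzP wyzP) // !inE eqxx.
Qed.

(** For (X6): [q] is the latest of the four, so Adversary can make its colour differ from that of
    [w], and both pairs then determine the same offer. This settles [w]; the claim for [q]
    follows. *)
Lemma selects_eq b x y w q z : x < q -> y < q -> w < q -> q < z ->
    selects b x y z -> selects b w q z ->
  selects true x y w /\ selects true x y q.
Proof.
move=> xq yq wq qz xyzP wqzP.
have lt (v : 'I_m) : v < q -> v < z by move/ltn_trans; apply.
have wP : selects true x y w.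
  move=> f fP xy; have [g [gP gf gq]] := answer_neq fP q (f w).
  have := selects_inj (lt _ xq) (lt _ yq) (lt _ wq) qz xyzP wqzP gP.
  rewrite (gf x) // (gf y) // (gf w) // (eq_sym (f w)) => /(_ xy gq)->.
  by rewrite !inE eqxx.
split=> // f fP xy; have [<-|wq'] := eqVneq (f w) (f q); first exact: wP.
rewrite (selects_inj (lt _ xq) (lt _ yq) (lt _ wq) qz xyzP wqzP) //.
by rewrite !inE eqxx orbT.
Qed.

(** For (X7): the same recolouring of [q], now with complementary pairs. *)
Lemma selects_neq b x y w q z : x < q -> y < q -> w < q -> q < z ->
    selects b x y z -> selects (~~ b) w q z ->
  selects false x y w /\ selects false x y q.
Proof.
move=> xq yq wq qz xyzP wqzP.
have lt (v : 'I_m) : v < q -> v < z by move/ltn_trans; apply.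
have wP : selects false x y w.
  move=> f fP xy; have [g [gP gf gq]] := answer_neq fP q (f w).
  have := selects_compl (lt _ xq) (lt _ yq) (lt _ wq) qz xyzP wqzP gP.
  rewrite (gf x) // (gf y) // (gf w) // (eq_sym (f w)) => /(_ xy gq)/setP/(_ (f w)).
  by rewrite in_setC !inE eqxx => /esym/negPf.
split=> // f fP xy; have [<-|wq'] := eqVneq (f w) (f q); first exact: wP.
have := selects_compl (lt _ xq) (lt _ yq) (lt _ wq) qz xyzP wqzP fP xy wq'.
by move=> /setP/(_ (f q)); rewrite in_setC !inE eqxx orbT => /esym/negPf.
Qed.

(** The cases follow the order of the constructors; each reduces to one of the facts above about a
    single rule. *)
Lemma closure_valid :
  (forall S, inF psi S -> validF S) /\ (forall b S, inR psi b S -> validR b S).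
Proof.
have ltE (x y w q z : 'I_m) :
    before [:: x; y; w] q -> q < z -> [/\ x < z, y < z & w < z].
  rewrite before3 => /and5P[_ _ _ xq /andP[yq wq]] qz.
  by split; apply: ltn_trans qz.
apply: inF_inR_ind.
- move=> x y xy; apply/validF2 => f fP; exact: sigma_wins xy.
- move=> x y w z; rewrite before3 => /and5P[xy xw yw xz /andP[yz wz]].
  move=> _ /validF2 wzP _ /(validR_elim xz yz) xyzP wlt; apply/validF2.
  have := apart_selects xz yz wz wzP xyzP.
  by case/(selects_false_apart xy xw yw wlt).
- move=> x y w z; rewrite before3 => /and5P[xy xw yw xz /andP[yz wz]].
  move=> _ /validF2 wzP _ /(validR_elim xz yz) xyzP wlt; apply/validF2.
  have := apart_selects xz yz wz wzP xyzP.
  by case/(selects_false_apart xy xw yw wlt).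
- move=> x y w z; rewrite before2 => /and3P[_ xy wy] yz.
  move=> _ /validR_plus xyzP _ /(validR_elim (ltn_trans wy yz) yz) wyzP.
  apply/validF2; exact: (selects_cross_apart xy wy yz xyzP wyzP).
- move=> b x y w q z bf qz; have [xz yz wz] := ltE _ _ _ _ _ bf qz.
  move: bf; rewrite before3 => /and5P[xy xw yw xq /andP[yq wq]].
  move=> _ /(validR_elim xz yz) xyzP _ /(validR_elim wz qz) wqzP wlt.
  have [xywP _] := selects_neq xq yq wq qz xyzP wqzP.
  by apply/validF2; case: (selects_false_apart xy xw yw wlt xywP).
- move=> b x y w q z bf qz; have [xz yz wz] := ltE _ _ _ _ _ bf qz.
  move: bf; rewrite before3 => /and5P[xy xw yw xq /andP[yq wq]].
  move=> _ /(validR_elim xz yz) xyzP _ /(validR_elim wz qz) wqzP wlt.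
  have [xywP _] := selects_neq xq yq wq qz xyzP wqzP.
  by apply/validF2; case: (selects_false_apart xy xw yw wlt xywP).
- move=> x y z; rewrite before2 => /and3P[_ xz yz].
  move=> _ /validF2 xzP _ /validF2 yzP.
  exact/(validR_minus xz yz)/apart2_selects.
- move=> x y w z; rewrite before3 => /and5P[_ _ _ xz /andP[yz wz]].
  move=> _ /validF2 wzP _ /(validR_elim xz yz) xyzP; apply/validR_plus.
  exact: apart_selects wzP xyzP.
- move=> x y w z; rewrite before3 => /and5P[_ _ _ xz /andP[yz wz]].
  move=> _ /validF2 wzP _ /validR_plus xyzP; rewrite before2 => /and3P[_ xw yw].
  exact/(validR_minus xw yw)/(apart_selects xz yz wz wzP xyzP).
- move=> x y w z; rewrite before2 => /and3P[_ xy wy] yz.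
  have xz := ltn_trans xy yz; have wz := ltn_trans wy yz.
  move=> _ /validR_plus xyzP _ /(validR_elim wz yz) wyzP; apply/validR_plus.
  exact: selects_cross xyzP wyzP.
- move=> b x y w z; rewrite before3 => /and5P[_ _ _ xz /andP[yz wz]].
  move=> _ /(validR_elim xz yz) xyzP _ /(validR_elim wz yz) wyzP.
  apply/validR_plus; exact: selects_common xyzP wyzP.
- move=> b x y w q z bf qz; have [xz yz wz] := ltE _ _ _ _ _ bf qz.
  move: bf; rewrite before3 => /and5P[xy xw yw xq /andP[yq wq]].
  move=> _ /(validR_elim xz yz) xyzP _ /(validR_elim wz qz) wqzP.
  by apply/validR_plus; case: (selects_eq xq yq wq qz xyzP wqzP).
- move=> b x y w q z bf qz; have [xz yz wz] := ltE _ _ _ _ _ bf qz.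
  move: bf; rewrite before3 => /and5P[xy xw yw xq /andP[yq wq]].
  move=> _ /(validR_elim xz yz) xyzP _ /(validR_elim wz qz) wqzP.
  by apply/validR_plus; case: (selects_eq xq yq wq qz xyzP wqzP).
- move=> b x y w q z bf qz; have [xz yz wz] := ltE _ _ _ _ _ bf qz.
  move: bf; rewrite before3 => /and5P[xy xw yw xq /andP[yq wq]].
  move=> _ /(validR_elim xz yz) xyzP _ /(validR_elim wz qz) wqzP.
  apply: validR_minus => //.
  by case: (selects_neq xq yq wq qz xyzP wqzP).
- move=> b x y w q z bf qz; have [xz yz wz] := ltE _ _ _ _ _ bf qz.
  move: bf; rewrite before3 => /and5P[xy xw yw xq /andP[yq wq]].
  move=> _ /(validR_elim xz yz) xyzP _ /(validR_elim wz qz) wqzP.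
  rewrite before2 => /and3P[_ xw' yw']; apply: validR_minus => //.
  by case: (selects_neq xq yq wq qz xyzP wqzP).
Qed.

End Soundness.

(** Serves to exclude the degenerate case [w = x] in the third clause of [bad_triple]. *)
Lemma inR_card m (psi : seq ('I_m * 'I_m)) b S : inR psi b S -> #|S| = 3.
Proof.
have card3 (x y z : 'I_m) : x != y -> x != z -> y != z -> #|[set x; y; z]| = 3.
  move=> xy xz yz; rewrite setUC cardsU1 cards2 xy !inE negb_or.
  by rewrite !(eq_sym z) xz yz.
have lt_neq (x y : 'I_m) : x < y -> x != y.
  by rewrite -val_eqE /= ltn_neqAle => /andP[].
case=> [x y z|x y w z|x y w z|x y w z|c x y w z|c x y w q z|c x y w q z
       |c x y w q z|c x y w q z]; rewrite ?before3 ?before2.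
- by case/and3P=> xy xz yz _ _; apply: card3; auto.
- by case/and5P=> xy xw yw _ _ _ _; apply: card3.
- by case/and5P=> xy xw yw _ _ _ _ _; apply: card3.
- by case/and3P=> xw xy wy _ _ _; apply: card3; rewrite 1?(eq_sym y); auto.
- by case/and5P=> xy xw yw _ _ _ _; apply: card3.
- by case/and5P=> xy xw yw _ _ _ _ _; apply: card3.
- by case/and5P=> xy _ _ xq /andP[yq _] _ _ _; apply: card3; auto.
- by case/and5P=> xy _ _ xq /andP[yq _] _ _ _; apply: card3; auto.
- by case/and5P=> xy xw yw _ _ _ _ _ _; apply: card3.
Qed.

(** * Truth of the sentence and the strategy of witnesses *)

Section Sentence.

Variables (m : nat) (psi : seq ('I_m * 'I_m)).

Definition suffix_of k : formula 'I_m :=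
  foldr (fun x phi => AtLeast 2 x phi) (matrix_of psi) (drop k (enum 'I_m)).

Lemma suffix_of_ord (x : 'I_m) : suffix_of x = AtLeast 2 x (suffix_of x.+1).
Proof. by rewrite /suffix_of (drop_nth x) ?size_enum_ord // nth_ord_enum. Qed.

Lemma suffix_of_ge k : m <= k -> suffix_of k = matrix_of psi.
Proof. by move=> mk; rewrite /suffix_of drop_oversize // size_enum_ord. Qed.

Lemma holds_matrix s :
  holds K4 s (matrix_of psi) = all (fun a => s a.1 != s a.2) psi.
Proof. by rewrite /matrix_of; elim: psi => //= a psi' ->. Qed.

(** The remaining quantifiers overwrite every variable from [k] on. *)
Lemma eq_holds_suffix k s s' : (forall x : 'I_m, x < k -> s x = s' x) ->
  holds K4 s (suffix_of k) = holds K4 s' (suffix_of k).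
Proof.
elim/(@downward_ind m): k s s' => [k mk|x IHx] s s' ss'.
  rewrite suffix_of_ge // !holds_matrix; apply: eq_all => a.
  by rewrite !ss' // (leq_trans _ mk).
rewrite suffix_of_ord /=; congr (1 < _); apply: eq_card => a; rewrite !inE.
apply: IHx => y; rewrite /upd ltnS leq_eqVlt val_eqE.
by case: eqP => //= _; apply: ss'.
Qed.

(** A [strategy] owes a two-element offer to every history, so where [A h] is too small the set of
    all colours replaces it. *)
Lemma strategy_within (A : seq 'I_4 -> {set 'I_4}) :
  exists sigma : strategy, forall h, 1 < #|A h| -> sigma h \subset A h.
Proof.
pose B h := if 1 < #|A h| then A h else setT.
have B2 h : 1 < #|B h| by rewrite /B; case: ifP; rewrite // cardsT card_ord.
have card_take h : #|[set a in take 2 (enum (B h))]| = 2.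
  rewrite cardsE (card_uniqP _) ?take_uniq ?enum_uniq //.
  by rewrite size_takel // -cardE.
exists (Strategy card_take) => h A2; apply/subsetP => a.
by rewrite inE /= => /mem_take; rewrite mem_enum /B A2.
Qed.

(** Prover offers two witnesses of the current quantifier, so the rest of the sentence stays true
    along every play. *)
Lemma models_prover_wins : models K4 (sentence_of psi) -> prover_wins psi.
Proof.
(* The default value [a] of [nth] gives the candidate colour to the variable of index [size h], the
   one being played. *)
move=> psiP; have [sigma sigmaP] := strategy_within
  (fun h => [set a | holds K4 (fun y : 'I_m => nth a h y) (suffix_of (size h).+1)]).
exists sigma => f fP.
have fk k : k <= m -> holds K4 f (suffix_of k).
  elim: k => [_|k IHk km]; first by have := psiP f; rewrite /suffix_of drop0.
  have := IHk (ltnW km); rewrite -[k]/(val (Ordinal km)); set x := Ordinal km.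
  rewrite suffix_of_ord /= => x2.
  have AE : [set a | holds K4 (fun y : 'I_m => nth a (history f x) y)
                       (suffix_of (size (history f x)).+1)]
          = [set a | holds K4 (upd f x a) (suffix_of x.+1)].
    apply/setP => a; rewrite !inE size_history; apply: eq_holds_suffix => y.
    rewrite /upd ltnS leq_eqVlt val_eqE.
    case: eqP => [-> _|_ /= yx]; last by rewrite nth_history.
    by rewrite nth_default ?size_history.
  have := sigmaP (history f x); rewrite /= AE => /(_ x2)/subsetP/(_ _ (fP x)).
  rewrite inE; congr (is_true _); apply: eq_holds_suffix => y _.
  by rewrite /upd; case: eqP => // ->.
have := fk m (leqnn m); rewrite suffix_of_ge // holds_matrix => /allP fpsi x y.
by rewrite /K4 => /orP[]/fpsi //=; rewrite eq_sym.
Qed.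

End Sentence.

(** * Consequences of a winning strategy *)

Lemma forced_sound m (psi : seq ('I_m * 'I_m)) : prover_wins psi ->
  prover_can_force (fun f => [/\ S1 psi f, S2 psi f & S3 psi f]).
Proof.
case=> sigma sigma_wins; exists sigma => f fP.
have [F_valid R_valid] := closure_valid sigma_wins.
split=> [x y /F_valid/validF2/(_ f fP)/eqP//|x y z xy yz|x y z xy yz].
  by move=> /R_valid/validR_plus xyzP /eqP; apply: xyzP.
have xz := ltn_trans xy yz.
by move=> /R_valid/(validR_elim xz yz) xyzP /eqP/(xyzP f fP)->.
Qed.

(** Once [x] and [y] differ in colour, the offer at [z] consists of their two colours, while every
    clause of badness lets Adversary reach a play in which one of these is forbidden at [z]. *)
Lemma forced_no_bad_triple m (psi : seq ('I_m * 'I_m)) :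
  prover_can_force (fun f => [/\ S1 psi f, S2 psi f & S3 psi f]) ->
  ~ exists x y z : 'I_m, bad_triple psi x y z.
Proof.
case=> sigma forces [x [y [z [xy yz xyzR bad]]]].
have xz := ltn_trans xy yz.
(* No vertex precedes 0, so this merely produces some play; the colour [ord0] is arbitrary. *)
have [f0 f0P _] : exists2 f, is_play sigma f & forall v : 'I_m, v < 0 -> f v = ord0.
  have [//|f fP _] := @extend_play m sigma 0 [ffun=> ord0].
  by exists f.
have split_at f (u v : 'I_m) : is_play sigma f -> u < v ->
    exists g : {ffun 'I_m -> 'I_4}, [/\ is_play sigma g,
      forall t : 'I_m, t < v -> g t = f t & g u != g v].
  move=> fP uv; have [g [gP gf gv]] := answer_neq fP v (f u).
  by exists g; split; rewrite // (gf u uv) eq_sym.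
have xyzP : selects sigma true x y z.
  by move=> f /forces[_ fS2 _] /eqP; apply: fS2.
have minusP (v w : 'I_m) : v < z -> w < z -> inRminus psi [set v; w; z] ->
    selects sigma false v w z.
  move=> vz wz vwzR f /forces[_ _ fS3] fvw; apply/negbTE.
  have [vw|wv|/val_inj vw] := ltngtP v w; last by rewrite vw eqxx in fvw.
    by apply: fS3 => //; apply/eqP.
  rewrite setUC; apply: fS3; rewrite // 1?set3C12 //.
  by apply/eqP; rewrite eq_sym.
have clashF f (v : 'I_m) : is_play sigma f -> f x != f y -> v < z ->
    f v \in [set f x; f y] -> ~ inF psi [set v; z].
  move=> fP fxy vz fv vzF.
  have vzP : apart sigma v z by move=> h /forces[/(_ _ _ vzF)/eqP].
  by have := apart_offer vz vzP fP; rewrite (selects_offer xz yz xyzP fP fxy) fv.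
have clashR f (v w : 'I_m) : is_play sigma f -> f x != f y ->
    f v != f w -> f v \in [set f x; f y] -> v < z -> w < z ->
    ~ inRminus psi [set v; w; z].
  move=> fP fxy fvw fv vz wz /(minusP _ _ vz wz) vwzP.
  have /setP/(_ (f v)) := selects_compl xz yz vz wz xyzP vwzP fP fxy fvw.
  by rewrite in_setC fv !inE eqxx.
have [f [fP _ fxy]] := split_at _ _ _ f0P xy.
case: bad => [||[w wz xwzR]|[w /andP[yw wz] ywzR]].
- by apply: (clashF f) => //; rewrite !inE eqxx.
- by apply: (clashF f) => //; rewrite !inE eqxx orbT.
(* The colour of [x] must differ from those of [y] and [w]. Adversary arranges this in the order of
   quantification, so that no later answer undoes an earlier one. *)
- suff [g [gP gxy gxw]] : exists g : {ffun 'I_m -> 'I_4},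
      [/\ is_play sigma g, g x != g y & g x != g w].
    by apply: (clashR g) xwzR => //; rewrite !inE eqxx.
  have [xw|wx|/val_inj xw] := ltngtP x w.
  + have [yw|wy|/val_inj <-] := ltngtP y w; last by exists f.
      have [g [gP gf gxw]] := split_at _ _ _ fP xw.
      by exists g; split; rewrite // !gf.
    have [g [gP gf gxw]] := split_at _ _ _ fP xw.
    have [h [hP hg hxy]] := split_at _ _ _ gP xy.
    by exists h; split; rewrite // !hg.
  + have [g [gP gf gwx]] := split_at _ _ _ fP wx.
    have [h [hP hg hxy]] := split_at _ _ _ gP xy.
    by exists h; split; rewrite // !hg ?(ltn_trans wx) // eq_sym.
  + by have := inR_card xwzR; rewrite xw setUid cards2; case: eqP.
have [g [gP gf gyw]] := split_at _ _ _ fP yw.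
have xw := ltn_trans xy yw.
by apply: (clashR g) ywzR; rewrite // ?gf // !inE ?eqxx ?orbT.
Qed.

(** * Completeness: extending a consistent colouring *)

Section Completeness.

Variables (m : nat) (psi : seq ('I_m * 'I_m)).
Implicit Types x y w q z : 'I_m.
Hypothesis loopless : forall x y : 'I_m, (x, y) \in psi -> x <> y.
Hypothesis no_bad : ~ exists x y z : 'I_m, bad_triple psi x y z.

(** Conditions (S1)-(S3) for the vertices before [k]; [s] is total so that it can serve as the
    assignment in [holds]. *)
Definition consistent k (s : 'I_m -> 'I_4) : Prop :=
  (forall x y, x < k -> y < k -> x != y -> inF psi [set x; y] -> s x != s y) /\
  (forall b x y z, x < z -> y < z -> z < k -> inR psi b [set x; y; z] ->
     s x != s y -> (s z \in [set s x; s y]) = b).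

Definition allowed z (s : 'I_m -> 'I_4) (a : 'I_4) : Prop :=
  (forall x, x < z -> inF psi [set x; z] -> s x != a) /\
  (forall b x y, x < z -> y < z -> inR psi b [set x; y; z] -> s x != s y ->
     (a \in [set s x; s y]) = b).

Lemma consistent_upd z s a :
  consistent z s -> allowed z s a -> consistent z.+1 (upd s z a).
Proof.
move=> [sF sR] [aF aR].
have upd_lt x : x < z -> upd s z a x = s x.
  by rewrite /upd -val_eqE => /ltn_eqF->.
have upd_z : upd s z a z = a by rewrite /upd eqxx.
split=> [x y|b x y v xv yv].
  rewrite !ltnS (leq_eqVlt x) (leq_eqVlt y).
  move=> /orP[/eqP/val_inj->|xz] /orP[/eqP/val_inj->|yz]; rewrite ?eqxx //.
  - by rewrite upd_z upd_lt // => _; rewrite setUC eq_sym; apply: aF.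
  - by rewrite upd_z upd_lt // => _; apply: aF.
  - by rewrite !upd_lt //; apply: sF.
rewrite ltnS leq_eqVlt => /orP[/eqP/val_inj vz|vz].
  by rewrite vz in xv yv *; rewrite upd_z !upd_lt //; apply: aR.
have xz := ltn_trans xv vz; have yz := ltn_trans yv vz.
by rewrite !upd_lt //; apply: sR.
Qed.

(** * Agreement of the conditions at the next vertex *)

Section NextVertex.

Variables (z : 'I_m) (s : 'I_m -> 'I_4).
Hypothesis s_ok : consistent z s.

Let sF x y : x < z -> y < z -> x != y -> inF psi [set x; y] -> s x != s y.
Proof. by case: s_ok => + _; apply. Qed.

Let sR b x y w : x < w -> y < w -> w < z -> inR psi b [set x; y; w] ->
  s x != s y -> (s w \in [set s x; s y]) = b.
Proof. by case: s_ok => _; apply. Qed.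

(** Three distinct colours would violate the condition at whichever of the three vertices comes
    last. *)
Lemma consistent_plus x y w : x < z -> y < z -> w < z ->
  inR psi true [set x; y; w] -> s x != s y -> s w \in [set s x; s y].
Proof.
move=> xz yz wz xywR sxy; apply/negPn/negP; rewrite !inE => /norP[swx swy].
have [xy xw yw] : [/\ x != y, x != w & y != w].
  split; first [by apply: contraNneq sxy => -> | by apply: contraNneq swx => ->
               | by apply: contraNneq swy => ->].
have : (x < w) && (y < w) \/ (x < y) && (w < y) \/ (y < x) && (w < x).
  by rewrite -!val_eqE /= in xy xw yw; lia.
case=> [|[]] /andP[lt1 lt2].
- by have := sR lt1 lt2 wz xywR sxy; rewrite !inE (negPf swx) (negPf swy).
- rewrite set3C23 in xywR; have := sR lt1 lt2 yz xywR.
  by rewrite !inE !(eq_sym (s y)) (negPf sxy) (negPf swy) eq_sym => /(_ swx).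
- rewrite set3C12 set3C23 in xywR; have := sR lt1 lt2 xz xywR.
  by rewrite !inE (negPf sxy) (eq_sym (s x)) (negPf swx) eq_sym => /(_ swy).
Qed.

(** A triple ending in [z] restricts its colour only if the two earlier colours differ. *)
Definition active b x y :=
  [/\ x < z, y < z, inR psi b [set x; y; z] & s x != s y].

Lemma active_sym b x y : active b x y -> active b y x.
Proof. by case=> xz yz xyzR sxy; split; rewrite // 1?set3C12 // eq_sym. Qed.

Lemma neq_of_colour x y : s x != s y -> x != y.
Proof. by apply: contraNneq => ->. Qed.

Lemma active_plus_noF x y : active true x y -> ~ inF psi [set x; z].
Proof.
case=> xz yz xyzR sxy xzF; apply: no_bad.
have [xy|yx|/val_inj xy] := ltngtP x y; last by rewrite xy eqxx in sxy.
  by exists x, y, z; split=> //; constructor 1.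
by exists y, x, z; split; rewrite // 1?set3C12 //; constructor 2.
Qed.

(** For [w] other than [x] and [y], (X3) gives an R- triple if [w] is later than both, and otherwise
    F-pairs of [w] with each; equality would be a bad triple. *)
Lemma active_plus_F x y w : active true x y -> w < z -> inF psi [set w; z] ->
  s w \notin [set s x; s y].
Proof.
move=> xyA wz wzF; have [xz yz xyzR sxy] := xyA.
have [wx|wx] := eqVneq w x.
  by case: (active_plus_noF xyA); rewrite -wx.
have [wy|wy] := eqVneq w y.
  by case: (active_plus_noF (active_sym xyA)); rewrite -wy.
have b3 : before [:: x; y; w] z.
  by rewrite before3 (neq_of_colour sxy) !(eq_sym _ w) wx wy xz yz wz.
case: (boolP (before [:: x; y] w)) => wlt.
  move: (wlt); rewrite before2 => /and3P[_ xw yw].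
  by rewrite (sR xw yw wz (X3_R b3 wzF xyzR wlt) sxy).
rewrite !inE negb_or !(eq_sym (s w)) !sF 1?eq_sym //.
  exact: X3_F2 b3 wzF xyzR wlt.
exact: X3_F1 b3 wzF xyzR wlt.
Qed.

Lemma active_minus_F x y w : active false x y -> w < z -> inF psi [set w; z] ->
  s w \in [set s x; s y].
Proof.
move=> [xz yz xyzR sxy] wz wzF.
have [->|wx] := eqVneq w x; first by rewrite !inE eqxx.
have [->|wy] := eqVneq w y; first by rewrite !inE eqxx orbT.
have b3 : before [:: x; y; w] z.
  by rewrite before3 (neq_of_colour sxy) !(eq_sym _ w) wx wy xz yz wz.
exact: consistent_plus (X2_R b3 wzF xyzR) sxy.
Qed.

Lemma active_common b x y w : active b x y -> active b w y ->
  [set s x; s y] = [set s w; s y].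
Proof.
move=> [xz yz xyzR sxy] [wz _ wyzR swy]; have [->//|wx] := eqVneq w x.
have b3 : before [:: x; y; w] z.
  rewrite before3 xz yz wz (neq_of_colour sxy) (eq_sym x) wx eq_sym.
  by rewrite (neq_of_colour swy).
apply: set2_eq => //; last by rewrite !inE eqxx orbT.
exact: consistent_plus (X5_R b3 xyzR wyzR) sxy.
Qed.

(** If [y] is later than [x] and [w], and these are distinct, (X4) forces three distinct colours on
    a triple of R+. All other cases give a bad triple. *)
Lemma active_opp_common x y w : active true x y -> ~ active false w y.
Proof.
move=> [xz yz xyzR sxy] [wz _ wyzR swy].
have [xy|yx|/val_inj xy] := ltngtP x y; last by rewrite xy eqxx in sxy.
  have [yw|wy|/val_inj wy] := ltngtP y w; last by rewrite wy eqxx in swy.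
    apply: no_bad; exists x, y, z; split=> //; constructor 4.
    by exists w; rewrite ?yw // /inRminus set3C12.
  have [xw|xw] := eqVneq x w.
    apply: no_bad; exists x, y, z; split=> //; constructor 3.
    by exists y; rewrite // xw.
  have b2 : before [:: x; w] y by rewrite before2 xw xy.
  have := sF xz wz xw (X4_F b2 yz xyzR wyzR).
  have := consistent_plus xz yz wz (X4_R b2 yz xyzR wyzR) sxy.
  by rewrite !inE (negPf swy) orbF eq_sym => ->.
apply: no_bad; exists y, x, z; split; rewrite // 1?set3C12 //; constructor 3.
by exists w; rewrite // /inRminus set3C12.
Qed.

(* The order assumed by (X6) and (X7). *)
Let top x y w q := [&& x != w, y != w, x < q, y < q & w < q].

Lemma top_before b x y w q : active b x y -> top x y w q ->
  before [:: x; y; w] q.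
Proof.
case=> _ _ _ /neq_of_colour xy /and5P[xw yw xq yq wq].
by rewrite before3 xy xw yw xq yq wq.
Qed.

Lemma active_eq_top b x y w q : active b x y -> active b w q ->
  top x y w q -> [set s x; s y] = [set s w; s q].
Proof.
move=> xyA wqA xywq; have b3 := top_before xyA xywq.
have [xz yz xyzR sxy] := xyA; have [wz qz wqzR swq] := wqA.
apply: set2_eq => //.
  exact: consistent_plus (X6_R1 b3 qz xyzR wqzR) sxy.
exact: consistent_plus (X6_R2 b3 qz xyzR wqzR) sxy.
Qed.

(** (X7) excludes the colour of [q] from the first pair; that of [w] is excluded through R- if [w]
    is later than [x] and [y], and through F otherwise. *)
Lemma active_opp_top b x y w q : active b x y -> active (~~ b) w q ->
  top x y w q -> [disjoint [set s x; s y] & [set s w; s q]].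
Proof.
move=> xyA wqA xywq; have b3 := top_before xyA xywq.
have [xz yz xyzR sxy] := xyA; have [wz qz wqzR swq] := wqA.
have [xw yw xq yq wq] := and5P xywq.
have sqP : s q \notin [set s x; s y].
  by rewrite (sR xq yq qz (X7_R1 b3 qz xyzR wqzR) sxy).
have swP : s w \notin [set s x; s y].
  case: (boolP (before [:: x; y] w)) => wlt.
    move: (wlt); rewrite before2 => /and3P[_ xw' yw'].
    by rewrite (sR xw' yw' wz (X7_R2 b3 qz xyzR wqzR wlt) sxy).
  rewrite !inE negb_or !(eq_sym (s w)) !sF //.
    exact: X7_F2 b3 qz xyzR wqzR wlt.
  exact: X7_F1 b3 qz xyzR wqzR wlt.
rewrite disjoint_sym disjoint_subset; apply/subsetP => c.
by rewrite in_set2 !inE => /orP[]/eqP->; rewrite -in_set2.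
Qed.

(** Swapping the pairs or the members of a pair brings the latest of four distinct vertices into the
    place of [q]. *)
Lemma top_exists x y w q : x != y -> w != q ->
  [|| x == w, x == q, y == w | y == q] \/
  top x y w q \/ top x y q w \/ top w q x y \/ top w q y x.
Proof.
by rewrite /top -!val_eqE /=; lia.
Qed.

Lemma active_eq b x y w q : active b x y -> active b w q ->
  [set s x; s y] = [set s w; s q].
Proof.
move=> xyA wqA; have yxA := active_sym xyA; have qwA := active_sym wqA.
have [_ _ _ /neq_of_colour xy] := xyA; have [_ _ _ /neq_of_colour wq] := wqA.
case: (top_exists xy wq) => [H|[H|[H|[H|H]]]].
- case/or4P: H => /eqP E; move: xyA yxA wqA qwA; rewrite E => xyA yxA wqA qwA.
  + by rewrite setUC (active_common yxA qwA) setUC.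
  + by rewrite setUC (active_common yxA wqA).
  + by rewrite (active_common xyA qwA) setUC.
  + exact: active_common xyA wqA.
- exact: active_eq_top xyA wqA H.
- by rewrite (active_eq_top xyA qwA H) setUC.
- by rewrite (active_eq_top wqA xyA H).
- by rewrite (active_eq_top wqA yxA H) setUC.
Qed.

Lemma active_opp x y w q : active true x y -> active false w q ->
  [disjoint [set s x; s y] & [set s w; s q]].
Proof.
move=> xyA wqA; have yxA := active_sym xyA; have qwA := active_sym wqA.
have [_ _ _ /neq_of_colour xy] := xyA; have [_ _ _ /neq_of_colour wq] := wqA.
case: (top_exists xy wq) => [H|[H|[H|[H|H]]]].
- case/or4P: H => /eqP E; move: xyA yxA wqA qwA; rewrite E => xyA yxA wqA qwA.
  + by case: (active_opp_common yxA qwA).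
  + by case: (active_opp_common yxA wqA).
  + by case: (active_opp_common xyA qwA).
  + by case: (active_opp_common xyA wqA).
- exact: active_opp_top xyA wqA H.
- by rewrite [[set s w; s q]]setUC; apply: active_opp_top xyA qwA H.
- by rewrite disjoint_sym; apply: active_opp_top wqA xyA H.
- by rewrite disjoint_sym [[set s x; s y]]setUC; apply: active_opp_top wqA yxA H.
Qed.

(** Membership in F, R+ and R- comes without a decision procedure, hence [classically]. The set [D]
    is the pair of an active R+ triple, else the complement of the pair of an active R- triple, else
    all colours but that of an F-neighbour, else everything. *)
Lemma allowed_pair :
  classically (exists2 D : {set 'I_4}, 1 < #|D| & {in D, forall a, allowed z s a}).
Proof.
move=> b0 pairP; apply: (@classic_EM (exists x y, active true x y) b0) => -[].
  case=> x [y xyA]; have [_ _ _ sxy] := xyA; apply: pairP.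
  exists [set s x; s y] => [|a aD]; first by rewrite cards2 sxy.
  split=> [w wz wzF|b w q wz qz wqzR swq].
    by apply: contraNneq (active_plus_F xyA wz wzF) => ->.
  case: b wqzR => wqzR; first by rewrite -(active_eq xyA).
  exact: disjointFr (active_opp xyA _) aD.
move=> no_plus; apply: (@classic_EM (exists x y, active false x y) b0) => -[].
  case=> x [y xyA]; have [_ _ _ sxy] := xyA; apply: pairP.
  exists (~: [set s x; s y]) => [|a].
    by rewrite cardsCs setCK card_ord cards2 sxy.
  rewrite in_setC => aD; split=> [w wz wzF|b w q wz qz wqzR swq].
    by apply: contraNneq aD => <-; apply: active_minus_F.
  case: b wqzR => wqzR; first by case: no_plus; exists w, q.
  by rewrite -(active_eq xyA) // (negPf aD).
move=> no_minus.
have no_active b w q : w < z -> q < z -> inR psi b [set w; q; z] -> s w == s q.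
  move=> wz qz wqzR; apply/negPn/negP => swq.
  by case: b wqzR => wqzR; [apply: no_plus | apply: no_minus]; exists w, q.
(* Without active triples, (X1) makes all earlier F-neighbours of [z] share one colour, so three
   colours remain. *)
apply: (@classic_EM (exists x, x < z /\ inF psi [set x; z]) b0) => -[].
  case=> x [xz xzF]; apply: pairP; exists [set~ s x]; first by rewrite cardsC1 card_ord.
  move=> a; rewrite !inE => ax; split=> [w wz wzF|b w q wz qz wqzR]; last first.
    by rewrite (no_active _ _ _ wz qz wqzR).
  have [->|wx] := eqVneq w x; first by rewrite eq_sym.
  have b2 : before [:: w; x] z by rewrite before2 wx wz.
  by rewrite (eqP (no_active _ _ _ wz xz (X1_R b2 wzF xzF))) eq_sym.
move=> noF; apply: pairP; exists setT => [|a _]; first by rewrite cardsT card_ord.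
split=> [w wz wzF|b w q wz qz wqzR]; first by case: noF; exists w.
by rewrite (no_active _ _ _ wz qz wqzR).
Qed.

End NextVertex.

(** Each allowed colour at [z] preserves consistency, so two of them witness the quantifier of
    [z]. *)
Lemma consistent_holds k s : consistent k s -> holds K4 s (suffix_of psi k).
Proof.
elim/(@downward_ind m): k s => [k mk|z IHz] s s_ok.
  rewrite suffix_of_ge // holds_matrix; apply/allP => -[x y] xy /=.
  case: s_ok => + _; apply; rewrite ?(leq_trans _ mk) //.
    exact/eqP/loopless.
  by apply: F_edge; rewrite /edge xy.
rewrite suffix_of_ord /=.
(* The goal is a boolean, so the classical statement can be eliminated into it. *)
apply: (allowed_pair s_ok) => -[D D2 DP]; apply: leq_trans D2 _.
apply/subset_leq_card/subsetP => a aD; rewrite inE.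
exact/IHz/consistent_upd/DP.
Qed.

End Completeness.

(** * The cycle of implications *)

Theorem theorem10 (m : nat) (psi : seq ('I_m * 'I_m))
    (loopless : forall x y : 'I_m, (x, y) \in psi -> x <> y) :
  [<-> models K4 (sentence_of psi);
       prover_wins psi;
       prover_can_force (fun f => [/\ S1 psi f, S2 psi f & S3 psi f]);
       ~ exists x y z : 'I_m, bad_triple psi x y z].
Proof.
tfae.
- exact: models_prover_wins.
- exact: forced_sound.
- exact: forced_no_bad_triple.
(* Before any vertex is coloured, consistency is vacuous. *)
move=> no_bad s; have := @consistent_holds m psi loopless no_bad 0 s.
by rewrite /suffix_of drop0; apply; split.
Qed.
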